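(* Let $p\ge 20$ be an integer and let $G_p=\langle a,t\mid t^{-1}a^{-1}tat^{-1}at=a^p\rangle$, with the word metric with respect to the generating set $\{a,t\}$. Then $a$ has infinite order and $t(a^\infty,a^{-\infty})\le\sqrt{12/17}$.
   Context: $d$ is the word metric of $G_p$ with respect to $\{a,t\}$. For $g$ of infinite order, $g^\infty=\{g^n:n\in\mathbb N\}$ and $g^{-\infty}=(g^{-1})^\infty$. For $\alpha>0$, $c\in\mathbb N$, the $(\alpha,c)$-cone around $g^\infty$ is $\alpha\cdot g^\infty+c=\{v:\exists n\in\mathbb N,\ d(v,g^n)\le\alpha\, d(1,g^n)+c\}$; for forward orbits $x,y$ write $x\subseteq\alpha\cdot y+c$ if every element of $x$ lies in the cone around $y$. Define $s(x,y)=\inf\{\alpha>0:\exists c\in\mathbb N,\ x\subseteq\alpha\cdot y+c\text{ and }y\subseteq\alpha\cdot x+c\}$ and $t(x,y)=\sqrt{s(x,y)}$. *)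

(* Defs.v *)
(* the group G_p is given by its presentation, with elements
   represented by words in a^{+-1}, t^{+-1} modulo the congruence generated by
   free cancellation and the defining relator. *)
From Stdlib Require Import Reals List ClassicalEpsilon.
Import ListNotations.
Open Scope R_scope.

Inductive letter : Type := La | LA | Lt | LT.  (* a, a^-1, t, t^-1 *)

Definition linv (x : letter) : letter :=
  match x with La => LA | LA => La | Lt => LT | LT => Lt end.

Definition word := list letter.

Definition winv (w : word) : word := rev (map linv w).

Fixpoint wpow (w : word) (n : nat) : word :=
  match n with O => [] | S k => w ++ wpow w k end.

(* relator  t^-1 a^-1 t a t^-1 a t a^-p  of  t^-1 a^-1 t a t^-1 a t = a^p *)
Definition relator (p : nat) : word :=
  [LT; LA; Lt; La; LT; La; Lt] ++ repeat LA p.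

Inductive weq (p : nat) : word -> word -> Prop :=
| weq_refl : forall u, weq p u u
| weq_sym : forall u v, weq p u v -> weq p v u
| weq_trans : forall u v w, weq p u v -> weq p v w -> weq p u w
| weq_free : forall u v x, weq p (u ++ x :: linv x :: v) (u ++ v)
| weq_rel : forall u v, weq p (u ++ relator p ++ v) (u ++ v).

Definition wlen (p : nat) (g : word) : nat :=
  epsilon (inhabits 0%nat)
    (fun n => (exists w, weq p g w /\ length w = n) /\
              (forall w, weq p g w -> (n <= length w)%nat)).

Definition dist (p : nat) (u v : word) : R := INR (wlen p (winv u ++ v)).

Definition in_cone (p : nat) (alpha : R) (c : nat) (g v : word) : Prop :=
  exists n : nat, dist p v (wpow g n) <= alpha * dist p [] (wpow g n) + INR c.

Definition sub_cone (p : nat) (alpha : R) (c : nat) (x y : word) : Prop :=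
  forall m : nat, in_cone p alpha c y (wpow x m).

(* the set whose infimum is s(x^infty, y^infty) *)
Definition s_set (p : nat) (x y : word) (alpha : R) : Prop :=
  0 < alpha /\ exists c : nat, sub_cone p alpha c x y /\ sub_cone p alpha c y x.

Definition is_glb (S : R -> Prop) (m : R) : Prop :=
  (forall x, S x -> m <= x) /\ (forall b, (forall x, S x -> b <= x) -> b <= m).

Definition infinite_order (p : nat) (g : word) : Prop :=
  forall n : nat, (0 < n)%nat -> ~ weq p (wpow g n) [].

(* Main.v *)
(* Write b = t^-1 a t, so that b^-1 a b = a^p, and let |n| be the word length of
   a^n. Britton normal forms over <a, b>, realised as affine maps of the line,
   show that a geodesic for a^n may be taken to be a product of letters a^(+-1)
   and of factors b^j = t^-1 a^j t of cost |j| + 2. It is a walk on levels in Z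
   that adds +-p^h whenever it stops at level h.
   The orbits of a and a^-1 are close if each m >= 1 has some n with
   |m + n| <= (2/3) |n| + O(1). Say p^(v-1) <= m < p^v, let z >= v minimise
   K = |z| over all integers >= v, put u = p z and n = p^u - m. Then m + n = p^u
   has length 2 K + O(1). The walk for n has to visit levels close to u and to v,
   so |n| >= |v| + |u - v| + |u| - O(1) >= 3 K - O(1), as v, u - v, u >= v.
   Finally 2/3 < 12/17. *)
Require Import Defs.
From Stdlib Require Import Reals List.
From Stdlib Require Import ZArith Lia Lra Classical ClassicalEpsilon Setoid Morphisms.
Import ListNotations.
Open Scope R_scope.

Lemma nat_least (Q : nat -> Prop) (n : nat) :
  Q n -> exists m, Q m /\ forall k, Q k -> (m <= k)%nat.
Proof.
  induction n as [n IH] using (well_founded_induction lt_wf). intros Hn.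
  destruct (classic (exists k, Q k /\ (k < n)%nat)) as [[k [Hk Hlt]]|Hno].
  - now apply (IH k).
  - exists n. split; [exact Hn|]. intros k Hk.
    destruct (Nat.le_gt_cases n k); [assumption|]. exfalso. eauto.
Qed.

(** * Words modulo the relator, and word length *)

Section BaumslagGersten.
Context (p : nat).

Lemma weq_app (u u' v v' : word) :
  weq p u u' -> weq p v v' -> weq p (u ++ v) (u' ++ v').
Proof.
  intros Hu Hv. apply weq_trans with (u' ++ v).
  - clear Hv. induction Hu.
    + apply weq_refl.
    + now apply weq_sym.
    + eapply weq_trans; eauto.
    + rewrite <- !app_assoc. apply weq_free.
    + rewrite <- !app_assoc. apply weq_rel.
  - clear Hu. induction Hv.
    + apply weq_refl.
    + now apply weq_sym.
    + eapply weq_trans; eauto.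
    + rewrite !(app_assoc u'). apply weq_free.
    + rewrite !(app_assoc u'). apply weq_rel.
Qed.

#[local] Instance weq_equivalence : Equivalence (weq p).
Proof.
  split; [exact (weq_refl p) | exact (weq_sym p) | exact (weq_trans p)].
Qed.

#[local] Instance weq_app_proper :
  Proper (weq p ==> weq p ==> weq p) (@app letter).
Proof. intros u u' Hu v v' Hv. now apply weq_app. Qed.

Lemma weq_winv_r (w : word) : weq p (w ++ winv w) [].
Proof.
  induction w as [|x w IH]; [reflexivity|].
  unfold winv in *. cbn [map rev].
  change (weq p ([x] ++ w ++ rev (map linv w) ++ [linv x]) []).
  rewrite (app_assoc w), IH. exact (weq_free p [] [] x).
Qed.

Lemma linv_involutive (x : letter) : linv (linv x) = x.
Proof. now destruct x. Qed.

Lemma winv_involutive (w : word) : winv (winv w) = w.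
Proof.
  unfold winv. rewrite map_rev, rev_involutive, map_map.
  rewrite (map_ext _ (fun x => x) linv_involutive). apply map_id.
Qed.

Lemma weq_winv_l (w : word) : weq p (winv w ++ w) [].
Proof. rewrite <- (winv_involutive w) at 2. apply weq_winv_r. Qed.

Lemma weq_winv (u v : word) : weq p u v -> weq p (winv u) (winv v).
Proof.
  intros H. transitivity (winv u ++ u ++ winv v).
  - rewrite <- (app_nil_r (winv u)) at 1. apply weq_app; [reflexivity|].
    rewrite <- (weq_winv_r v). apply weq_app; [now symmetry | reflexivity].
  - now rewrite app_assoc, weq_winv_l.
Qed.

Lemma winv_app (u v : word) : winv (u ++ v) = winv v ++ winv u.
Proof. unfold winv. now rewrite map_app, rev_app_distr. Qed.

Lemma length_winv (w : word) : length (winv w) = length w.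
Proof. unfold winv. now rewrite length_rev, length_map. Qed.

(** The [epsilon] term is the minimum, since the set of lengths of spellings contains [length g]. *)
Lemma wlen_spec (g : word) :
  (exists w, weq p g w /\ length w = wlen p g) /\
  (forall w, weq p g w -> (wlen p g <= length w)%nat).
Proof.
  unfold wlen. apply epsilon_spec.
  destruct (nat_least (fun n => exists w, weq p g w /\ length w = n) (length g))
    as [n [Hn Hmin]].
  { exists g. split; reflexivity. }
  exists n. split; [exact Hn|]. intros w Hw. apply Hmin. exists w. auto.
Qed.

Lemma wlen_ext (g h : word) : weq p g h -> wlen p g = wlen p h.
Proof.
  intros H.
  destruct (wlen_spec g) as [[u [Hu Eu]] Mu], (wlen_spec h) as [[v [Hv Ev]] Mv].
  apply Nat.le_antisymm.
  - rewrite <- Ev. apply Mu. now rewrite H.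
  - rewrite <- Eu. apply Mv. now rewrite <- H.
Qed.

Lemma wlen_winv (g : word) : wlen p (winv g) = wlen p g.
Proof.
  assert (H : forall h, (wlen p (winv h) <= wlen p h)%nat).
  { intros h. destruct (wlen_spec h) as [[u [Hu Eu]] _].
    rewrite <- Eu, <- length_winv. apply wlen_spec. now apply weq_winv. }
  apply Nat.le_antisymm; [apply H|].
  rewrite <- (winv_involutive g) at 1. apply H.
Qed.

(** * Powers of [a] and of [b = t^-1 a t] *)

Definition apow (k : Z) : word :=
  if (0 <=? k)%Z then repeat La (Z.to_nat k) else repeat LA (Z.to_nat (- k)).

Lemma apow_succ (k : Z) : weq p (apow k ++ [La]) (apow (k + 1)).
Proof.
  unfold apow. destruct (Z.leb_spec 0 k), (Z.leb_spec 0 (k + 1)); try lia.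
  - replace (Z.to_nat (k + 1)) with (S (Z.to_nat k)) by lia.
    now rewrite <- repeat_cons.
  - replace (Z.to_nat (- k)) with 1%nat by lia.
    replace (Z.to_nat (k + 1)) with 0%nat by lia. exact (weq_free p [] [] LA).
  - replace (Z.to_nat (- k)) with (S (Z.to_nat (- (k + 1)))) by lia.
    cbn [repeat]. rewrite repeat_cons, <- app_assoc.
    rewrite (weq_free p _ [] LA). now rewrite app_nil_r.
Qed.

Lemma apow_pred (k : Z) : weq p (apow k ++ [LA]) (apow (k - 1)).
Proof.
  replace k with ((k - 1) + 1)%Z at 1 by lia.
  rewrite <- apow_succ, <- app_assoc.
  cbn [app]. now rewrite (weq_free p _ [] La), app_nil_r.
Qed.

Lemma apow_add (i j : Z) : weq p (apow i ++ apow j) (apow (i + j)).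
Proof.
  induction j using Z.peano_ind.
  - cbn. now rewrite app_nil_r, Z.add_0_r.
  - unfold Z.succ. now rewrite <- apow_succ, app_assoc, IHj, apow_succ, Z.add_assoc.
  - unfold Z.pred.
    change (j + -1)%Z with (j - 1)%Z.
    now rewrite <- apow_pred, app_assoc, IHj, apow_pred, Z.add_sub_assoc.
Qed.

Definition bpow (k : Z) : word := [LT] ++ apow k ++ [Lt].

Lemma bpow_0 : weq p (bpow 0) [].
Proof. exact (weq_free p [] [] LT). Qed.

Lemma bpow_add (i j : Z) : weq p (bpow i ++ bpow j) (bpow (i + j)).
Proof.
  unfold bpow. rewrite <- apow_add.
  pose proof (weq_free p ([LT] ++ apow i) (apow j ++ [Lt]) Lt) as H.
  rewrite <- !app_assoc in *. exact H.
Qed.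

Lemma conj_relation : weq p (bpow (-1) ++ [La] ++ bpow 1) (apow (Z.of_nat p)).
Proof.
  pose proof (weq_rel p [] []) as H. unfold relator in H.
  rewrite app_nil_l, !app_nil_r in H.
  assert (E : weq p (repeat LA p ++ apow (Z.of_nat p)) []).
  { replace (repeat LA p) with (winv (apow (Z.of_nat p))); [apply weq_winv_l|].
    unfold apow. destruct (Z.leb_spec 0 (Z.of_nat p)); [|lia].
    unfold winv. now rewrite Nat2Z.id, map_repeat, rev_repeat. }
  change (weq p ([LT; LA; Lt; La; LT; La; Lt]) (apow (Z.of_nat p))).
  revert H. generalize [LT; LA; Lt; La; LT; La; Lt]. intros w H.
  rewrite <- (app_nil_r w), <- E, app_assoc, H. reflexivity.
Qed.

Lemma apow_bpow1 (y : Z) :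
  weq p (apow y ++ bpow 1) (bpow 1 ++ apow (y * Z.of_nat p)).
Proof.
  assert (S1 : weq p ([La] ++ bpow 1) (bpow 1 ++ apow (Z.of_nat p))).
  { now rewrite <- conj_relation, (app_assoc (bpow 1)), bpow_add, bpow_0. }
  assert (S2 : weq p ([LA] ++ bpow 1) (bpow 1 ++ apow (- Z.of_nat p))).
  { transitivity ([LA] ++ (bpow 1 ++ apow (Z.of_nat p)) ++ apow (- Z.of_nat p)).
    - rewrite <- (app_assoc (bpow 1)), apow_add, Z.add_opp_diag_r. 
      change (apow 0) with (@nil letter). now rewrite app_nil_r.
    - rewrite <- S1, <- app_assoc. exact (weq_free p [] _ LA). }
  induction y using Z.peano_ind.
  - cbn. now rewrite app_nil_r.
  - unfold Z.succ. rewrite <- apow_succ, <- app_assoc, S1, app_assoc, IHy.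
    rewrite <- app_assoc, apow_add. now replace ((y + 1) * Z.of_nat p)%Z with
      (y * Z.of_nat p + Z.of_nat p)%Z by ring.
  - change (Z.pred y) with (y - 1)%Z.
    rewrite <- apow_pred, <- app_assoc, S2, app_assoc, IHy.
    rewrite <- app_assoc, apow_add. now replace ((y - 1) * Z.of_nat p)%Z with
      (y * Z.of_nat p + - Z.of_nat p)%Z by ring.
Qed.

(** Iterates [a b = b a^p]. The exponent [i] is natural, as passing a negative power of [b] would
    divide by [p]. *)
Lemma apow_bpow (y : Z) (i : nat) :
  weq p (apow y ++ bpow (Z.of_nat i))
        (bpow (Z.of_nat i) ++ apow (y * Z.of_nat p ^ Z.of_nat i)).
Proof.
  induction i as [|i IH].
  - change (Z.of_nat 0) with 0%Z. now rewrite bpow_0, app_nil_r, Z.mul_1_r.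
  - rewrite Nat2Z.inj_succ. unfold Z.succ.
    rewrite <- bpow_add, app_assoc, IH, <- !app_assoc, apow_bpow1.
    rewrite Z.pow_add_r by lia. now rewrite Z.pow_1_r, Z.mul_assoc.
Qed.

Lemma wpow_La (m : nat) : wpow [La] m = apow (Z.of_nat m).
Proof.
  unfold apow. destruct (Z.leb_spec 0 (Z.of_nat m)); [|lia]. rewrite Nat2Z.id.
  clear. induction m as [|m IH]; [reflexivity|]. cbn in *. now rewrite IH.
Qed.

Lemma wpow_LA (m : nat) : wpow [LA] m = winv (apow (Z.of_nat m)).
Proof.
  unfold apow, winv. destruct (Z.leb_spec 0 (Z.of_nat m)); [|lia].
  rewrite Nat2Z.id, map_repeat, rev_repeat.
  clear. induction m as [|m IH]; [reflexivity|]. cbn in *. now rewrite IH.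
Qed.

(** * Upper bounds for the length of powers of [a] *)

Definition alen (k : Z) : nat := wlen p (apow k).

Lemma apow_opp (k : Z) : weq p (apow (- k)) (winv (apow k)).
Proof.
  rewrite <- (app_nil_r (apow (- k))), <- (weq_winv_r (apow k)), app_assoc.
  rewrite apow_add, Z.add_opp_diag_l. reflexivity.
Qed.

Lemma alen_opp (k : Z) : alen (- k) = alen k.
Proof. unfold alen. now rewrite (wlen_ext _ _ (apow_opp k)), wlen_winv. Qed.

Lemma alen_0 : alen 0 = 0%nat.
Proof.
  pose proof (proj2 (wlen_spec (apow 0)) [] (weq_refl _ _)) as H.
  cbn [length] in H. unfold alen. lia.
Qed.

Lemma alen_le_length (k : Z) (w : word) :
  weq p (apow k) w -> (alen k <= length w)%nat.
Proof. apply wlen_spec. Qed.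

Lemma alen_witness (k : Z) : exists w, weq p (apow k) w /\ length w = alen k.
Proof. apply wlen_spec. Qed.

Lemma alen_add (i j : Z) : (alen (i + j) <= alen i + alen j)%nat.
Proof.
  destruct (alen_witness i) as [u [Hu Eu]], (alen_witness j) as [v [Hv Ev]].
  rewrite <- Eu, <- Ev, <- length_app. apply alen_le_length.
  now rewrite <- Hu, <- Hv, apow_add.
Qed.

Lemma alen_le_abs (k : Z) : (alen k <= Z.abs_nat k)%nat.
Proof.
  transitivity (length (apow k)); [now apply alen_le_length|].
  unfold apow. destruct (Z.leb_spec 0 k); rewrite repeat_length; lia.
Qed.

Lemma alen_close (i j : Z) : (alen i <= alen j + Z.abs_nat (i - j))%nat.
Proof.
  replace i with (j + (i - j))%Z at 1 by lia.
  pose proof (alen_add j (i - j)). pose proof (alen_le_abs (i - j)). lia.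
Qed.

(** [a^(k p) = b^-1 a^k b], with three letters for each of [b] and [b^-1]. *)
Lemma alen_mul_p (k : Z) : (alen (k * Z.of_nat p) <= alen k + 6)%nat.
Proof.
  destruct (alen_witness k) as [w [Hw E]].
  transitivity (length (bpow (-1) ++ w ++ bpow 1)).
  - apply alen_le_length. rewrite <- Hw, apow_bpow1, app_assoc, bpow_add.
    change (-1 + 1)%Z with 0%Z. now rewrite bpow_0.
  - rewrite !length_app, E. change (length (bpow (-1))) with 3%nat.
    change (length (bpow 1)) with 3%nat. lia.
Qed.

(** [a^(p^k) = b^-k a b^k]; with geodesics inside the outer factors this takes [2 (|k| + 2) + 1]
    letters. *)
Lemma alen_pow_p (k : nat) :
  (alen (Z.of_nat p ^ Z.of_nat k) <= 2 * alen (Z.of_nat k) + 5)%nat.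
Proof.
  destruct (alen_witness (Z.of_nat k)) as [w [Hw E]].
  transitivity (length (([LT] ++ winv w ++ [Lt]) ++ apow 1 ++ [LT] ++ w ++ [Lt])).
  - apply alen_le_length. rewrite <- (weq_winv _ _ Hw), <- apow_opp, <- Hw.
    change (weq p (apow (Z.of_nat p ^ Z.of_nat k))
      (bpow (- Z.of_nat k) ++ apow 1 ++ bpow (Z.of_nat k))).
    rewrite apow_bpow, app_assoc, bpow_add, Z.add_opp_diag_l, bpow_0, Z.mul_1_l.
    reflexivity.
  - rewrite !length_app, length_winv, E.
    change (length (apow 1)) with 1%nat. cbn [length]. lia.
Qed.

Context (p_gt1 : (1 < p)%nat).

(** * The affine model of the subgroup generated by [a] and [b] *)

Definition pw (z : Z) : R := powerRZ (INR p) z.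

Lemma p_gt1_R : 1 < INR p.
Proof. now apply (lt_INR 1). Qed.

Lemma p_neq0 : INR p <> 0.
Proof. pose proof p_gt1_R. lra. Qed.

Lemma pw_pos (z : Z) : 0 < pw z.
Proof. pose proof p_gt1_R. apply powerRZ_lt. lra. Qed.

Lemma pw_add (i j : Z) : pw (i + j) = pw i * pw j.
Proof. apply powerRZ_add, p_neq0. Qed.

Lemma pw_nat (n : nat) : pw (Z.of_nat n) = INR p ^ n.
Proof. symmetry. apply pow_powerRZ. Qed.

Lemma pw_IZR (z : Z) : (0 <= z)%Z -> pw z = IZR (Z.of_nat p ^ z).
Proof.
  intros Hz. rewrite <- (Z2Nat.id z Hz), pw_nat, INR_IZR_INZ.
  apply pow_IZR.
Qed.

Lemma pw_opp (z : Z) : pw z * pw (- z) = 1.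
Proof. rewrite <- pw_add, Z.add_opp_diag_r. reflexivity. Qed.

Lemma pw_le (i j : Z) : (i <= j)%Z -> pw i <= pw j.
Proof.
  intros H. replace j with (i + Z.of_nat (Z.to_nat (j - i)))%Z by lia.
  rewrite pw_add, pw_nat, <- (Rmult_1_r (pw i)) at 1.
  apply Rmult_le_compat_l; [apply Rlt_le, pw_pos|].
  apply pow_R1_Rle. pose proof p_gt1_R. lra.
Qed.

(* [(x, s)] is the map [y |-> x + p^(-s) y]; [a] acts as [(1, 0)] and [b] as
   [(0, 1)], so that [<a, b>] embeds with [<a> = gen true] and [<b> = gen false]. *)
Definition affine : Type := (R * Z)%type.
Definition aone : affine := (0, 0%Z).
Definition amul (g h : affine) : affine :=
  (fst g + pw (- snd g) * fst h, (snd g + snd h)%Z).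

Lemma amul_assoc (f g h : affine) : amul f (amul g h) = amul (amul f g) h.
Proof.
  unfold amul; cbn. f_equal; [|lia].
  replace (- (snd f + snd g))%Z with (- snd f + - snd g)%Z by lia.
  rewrite pw_add. ring.
Qed.

Lemma amul_1_r (g : affine) : amul g aone = g.
Proof. destruct g. unfold amul; cbn. f_equal; [ring | lia]. Qed.

Lemma amul_1_l (g : affine) : amul aone g = g.
Proof. destruct g. unfold amul; cbn. f_equal. unfold pw. cbn. ring. Qed.

Definition gen (b : bool) (k : Z) : affine := if b then (IZR k, 0%Z) else (0, k).

Lemma gen_0 (b : bool) : gen b 0 = aone.
Proof. now destruct b. Qed.

Lemma gen_add (b : bool) (i j : Z) : amul (gen b i) (gen b j) = gen b (i + j).
Proof.
  destruct b; unfold amul; cbn; f_equal; try ring.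
  unfold pw. cbn. rewrite plus_IZR. ring.
Qed.

Lemma gen_inj (b : bool) (i j : Z) : gen b i = gen b j -> i = j.
Proof.
  destruct b; cbn; intros H; injection H; auto. intros E. now apply eq_IZR.
Qed.

(** The exponent [k] in [h = rep b h * gen b k]. Multiplying [(x, s)] by [a^k] on the right adds [k]
    to [x p^s], so the floor selects the representative with [x p^s] in [[0, 1)]; for [b] it is the
    one with [s = 0]. *)
Definition coord (b : bool) (h : affine) : Z :=
  if b then Int_part (fst h * pw (snd h)) else snd h.

Lemma coord_1 (b : bool) : coord b aone = 0%Z.
Proof.
  destruct b; [|reflexivity]. cbn. symmetry. apply Int_part_spec. cbn. lra.
Qed.

Lemma coord_mul_gen (b : bool) (h : affine) (k : Z) :
  coord b (amul h (gen b k)) = (coord b h + k)%Z.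
Proof.
  destruct b; cbn; [|lia]. symmetry. apply Int_part_spec.
  rewrite Z.add_0_r, plus_IZR.
  replace ((fst h + pw (- snd h) * IZR k) * pw (snd h))
    with (fst h * pw (snd h) + IZR k * (pw (snd h) * pw (- snd h))) by ring.
  rewrite pw_opp. pose proof (base_Int_part (fst h * pw (snd h))). lra.
Qed.

Lemma coord_gen (b : bool) (k : Z) : coord b (gen b k) = k.
Proof. now rewrite <- (amul_1_l (gen b k)), coord_mul_gen, coord_1. Qed.

Definition rep (b : bool) (h : affine) : affine := amul h (gen b (- coord b h)).

Lemma rep_mul_gen (b : bool) (h : affine) (k : Z) :
  rep b (amul h (gen b k)) = rep b h.
Proof.
  unfold rep. rewrite coord_mul_gen, <- amul_assoc, gen_add. do 2 f_equal. lia.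
Qed.

Lemma rep_coord (b : bool) (h : affine) : amul (rep b h) (gen b (coord b h)) = h.
Proof.
  unfold rep. rewrite <- amul_assoc, gen_add, Z.add_opp_diag_l, gen_0.
  apply amul_1_r.
Qed.

Lemma coord_rep (b : bool) (h : affine) : coord b (rep b h) = 0%Z.
Proof. unfold rep. rewrite coord_mul_gen. lia. Qed.

Lemma rep_of_coord_0 (b : bool) (h : affine) : coord b h = 0%Z -> rep b h = h.
Proof. intros H. unfold rep. rewrite H. cbn. rewrite gen_0. apply amul_1_r. Qed.

Lemma rep_gen (b : bool) (k : Z) : rep b (gen b k) = aone.
Proof.
  rewrite <- (amul_1_l (gen b k)), rep_mul_gen. apply rep_of_coord_0, coord_1.
Qed.

(** * Britton normal forms and the action of words on them *)

(* The frames of a state, innermost first, spell the part of a Britton normal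
   form to the left of its last factor: [(r, true)] stands for [r t] and
   [(r, false)] for [r t^-1], where [r] is a chosen representative of a left
   coset of [<a>], respectively [<b>]. *)
Definition state : Type := (list (affine * bool) * affine)%type.

Definition rmul (s : state) (g : affine) : state := (fst s, amul (snd s) g).

(** A Britton pinch: the new stable letter closes [t^-1 a^k t] or [t b^k t^-1]. *)
Definition cancels (b : bool) (s : state) : Prop :=
  exists r l, fst s = (r, negb b) :: l /\ rep b (snd s) = aone.

(** Right multiplication by [t] ([b] true) or [t^-1]. A pinch such as [r t^-1 a^k t] collapses to
    [r b^k]; otherwise the subgroup part of the last factor moves across, as in [a^k t = t b^k], and
    the coset representative stays in the frame. *)
Definition turn (b : bool) (s : state) : state :=
  let push := ((rep b (snd s), b) :: fst s, gen (negb b) (coord b (snd s))) in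
  match fst s with
  | (r, _) :: l =>
      if excluded_middle_informative (cancels b s)
      then (l, amul r (gen (negb b) (coord b (snd s)))) else push
  | [] => push
  end.

Fixpoint reduced (l : list (affine * bool)) : Prop :=
  match l with
  | [] => True
  | (r, b) :: l' => coord b r = 0%Z /\ ~ cancels b (l', r) /\ reduced l'
  end.

Lemma turn_cancel (b : bool) r l h :
  rep b h = aone ->
  turn b ((r, negb b) :: l, h) = (l, amul r (gen (negb b) (coord b h))).
Proof.
  intros H. unfold turn. cbn [fst snd].
  destruct (excluded_middle_informative _) as [|n]; [reflexivity|].
  exfalso. apply n. exists r, l. auto.
Qed.

Lemma turn_push (b : bool) (s : state) :
  ~ cancels b s ->
  turn b s = ((rep b (snd s), b) :: fst s, gen (negb b) (coord b (snd s))).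
Proof.
  intros H. unfold turn. destruct (fst s) as [|[r b'] l]; [reflexivity|].
  destruct (excluded_middle_informative _); [contradiction | reflexivity].
Qed.

Lemma cancels_rep (b : bool) l h :
  cancels b (l, rep b h) <-> cancels b (l, h).
Proof.
  unfold cancels. cbn [fst snd].
  now rewrite (rep_of_coord_0 b (rep b h)) by apply coord_rep.
Qed.

Lemma turn_reduced (b : bool) (s : state) : reduced (fst s) -> reduced (fst (turn b s)).
Proof.
  destruct s as [l h]. intros Hr.
  destruct (classic (cancels b (l, h))) as [Hc|Hn].
  - destruct Hc as (r & l' & E & Hh). cbn [fst snd] in *. subst l.
    rewrite turn_cancel by assumption. now apply Hr.
  - rewrite turn_push by assumption. cbn [fst snd reduced]. repeat split; trivial.
    + apply coord_rep.
    + now rewrite cancels_rep.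
Qed.

(* The relation [t^-1 a^k t = b^k], and its converse, as identities between
   permutations of reduced states. *)
Lemma turn_conj (b : bool) (k : Z) (s : state) :
  reduced (fst s) ->
  turn (negb b) (rmul (turn b s) (gen (negb b) k)) = rmul s (gen b k).
Proof.
  destruct s as [l h]. intros Hr.
  destruct (classic (cancels b (l, h))) as [Hc|Hn].
  - destruct Hc as (r & l' & E & Hh). cbn [fst snd] in *. subst l.
    rewrite turn_cancel by assumption. unfold rmul; cbn [fst snd].
    destruct Hr as (Hr0 & Hnc & _).
    rewrite <- amul_assoc, gen_add.
    (* No second pinch occurs: the stack was reduced, and [cancels] depends only on the coset of
       [r]. *)
    rewrite turn_push.
    + cbn [fst snd]. rewrite rep_mul_gen, (rep_of_coord_0 _ r Hr0), coord_mul_gen, Hr0.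
      rewrite Bool.negb_involutive. do 2 f_equal.
      rewrite <- (rep_coord b h) at 2. rewrite Hh, amul_1_l, gen_add.
      reflexivity.
    + unfold cancels in *. cbn [fst snd] in *. now rewrite rep_mul_gen.
  - rewrite (turn_push b (l, h) Hn). unfold rmul; cbn [fst snd].
    rewrite gen_add.
    pose proof (turn_cancel (negb b) (rep b h) l (gen (negb b) (coord b h + k))) as H.
    rewrite Bool.negb_involutive in H. rewrite H by apply rep_gen.
    rewrite coord_gen, <- gen_add, amul_assoc, rep_coord. reflexivity.
Qed.

Definition act (s : state) (x : letter) : state :=
  match x with
  | La => rmul s (gen true 1)
  | LA => rmul s (gen true (-1))
  | Lt => turn true s
  | LT => turn false s
  end.

Definition run (w : word) (s : state) : state := fold_left act w s.

Lemma run_app (u v : word) (s : state) : run (u ++ v) s = run v (run u s).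
Proof. apply fold_left_app. Qed.

Lemma act_reduced (x : letter) (s : state) : reduced (fst s) -> reduced (fst (act s x)).
Proof. destruct x; cbn [act]; trivial; apply turn_reduced. Qed.

Lemma run_reduced (w : word) (s : state) : reduced (fst s) -> reduced (fst (run w s)).
Proof.
  revert s. induction w as [|x w IH]; intros s H; [exact H|].
  now apply IH, act_reduced.
Qed.

Lemma rmul_rmul (s : state) g h : rmul (rmul s g) h = rmul s (amul g h).
Proof. unfold rmul. cbn. now rewrite amul_assoc. Qed.

Lemma rmul_1 (s : state) : rmul s aone = s.
Proof. destruct s. unfold rmul. cbn. now rewrite amul_1_r. Qed.

Lemma turn_turn (b : bool) (s : state) :
  reduced (fst s) -> turn (negb b) (turn b s) = s.
Proof.
  intros H. pose proof (turn_conj b 0 s H) as E.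
  now rewrite !gen_0, !rmul_1 in E.
Qed.

Lemma act_linv (x : letter) (s : state) : reduced (fst s) -> act (act s x) (linv x) = s.
Proof.
  intros H. destruct x; cbn [act linv].
  - now rewrite rmul_rmul, gen_add, gen_0, rmul_1.
  - now rewrite rmul_rmul, gen_add, gen_0, rmul_1.
  - exact (turn_turn true s H).
  - exact (turn_turn false s H).
Qed.

Lemma run_repeat_La (n : nat) (s : state) :
  run (repeat La n) s = rmul s (gen true (Z.of_nat n)).
Proof.
  revert s. induction n as [|n IH]; intros s.
  - symmetry. now rewrite gen_0, rmul_1.
  - cbn [repeat]. change (run (La :: repeat La n) s) with (run (repeat La n) (act s La)).
    rewrite IH. cbn [act]. rewrite rmul_rmul, gen_add. do 2 f_equal. lia.
Qed.

Lemma run_repeat_LA (n : nat) (s : state) :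
  run (repeat LA n) s = rmul s (gen true (- Z.of_nat n)).
Proof.
  revert s. induction n as [|n IH]; intros s.
  - symmetry. now rewrite gen_0, rmul_1.
  - cbn [repeat]. change (run (LA :: repeat LA n) s) with (run (repeat LA n) (act s LA)).
    rewrite IH. cbn [act]. rewrite rmul_rmul, gen_add. do 2 f_equal. lia.
Qed.

Lemma run_apow (k : Z) (s : state) : run (apow k) s = rmul s (gen true k).
Proof.
  unfold apow. destruct (Z.leb_spec 0 k).
  - rewrite run_repeat_La. do 2 f_equal. lia.
  - rewrite run_repeat_LA. do 2 f_equal. lia.
Qed.

(** The relator is [b^-1 a b a^-p]. By [turn_conj] each [b^k] acts as right multiplication, and the
    product is trivial in the affine model. *)
Lemma run_relator (s : state) : reduced (fst s) -> run (relator p) s = s.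
Proof.
  intros H. unfold relator. rewrite run_app, run_repeat_LA. cbn [run fold_left act].
  pose proof (turn_conj false (-1) s H) as E1.
  pose proof (turn_conj false 1 (rmul (rmul s (gen false (-1))) (gen true 1)) H) as E2.
  cbn [negb] in E1, E2. rewrite E1, E2, !rmul_rmul.
  rewrite <- (rmul_1 s) at 2. f_equal.
  unfold amul, aone; cbn. rewrite opp_IZR, <- INR_IZR_INZ. f_equal.
  unfold pw; cbn. change (Pos.to_nat 1) with 1%nat. field. exact p_neq0.
Qed.

Lemma run_weq (u v : word) (s : state) :
  weq p u v -> reduced (fst s) -> run u s = run v s.
Proof.
  intros H. revert s. induction H as [| | |u v x|u v]; intros s Hs.
  - reflexivity.
  - symmetry; auto.
  - now rewrite IHweq1, IHweq2.
  - rewrite !run_app. cbn [run fold_left].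
    fold (run v (act (act (run u s) x) (linv x))).
    now rewrite act_linv by now apply run_reduced.
  - rewrite !run_app, run_relator; [reflexivity | now apply run_reduced].
Qed.

Definition start : state := ([], aone).

(** [a^i] takes [start] to the last factor [gen true i], from which [i] can be read off. *)
Lemma apow_inj (i j : Z) : weq p (apow i) (apow j) -> i = j.
Proof.
  intros H. pose proof (run_weq _ _ start H I) as E.
  rewrite !run_apow in E. unfold rmul, start in E. cbn [fst snd] in E.
  rewrite !amul_1_l in E. apply (gen_inj true). congruence.
Qed.

(** * Costs in the affine model, bounded by word length *)

(* A factor [b^j] costs 2 more than some spelling of [a^j], being spelled
   [t^-1 a^j t]; the letters [a^(+-1)] cost 1. *)
Inductive reach : nat -> affine -> Prop :=
| reach_one : reach 0 aone
| reach_a c g e : reach c g -> e = 1%Z \/ e = (-1)%Z ->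
    reach (S c) (amul g (gen true e))
| reach_b c c' g j : reach c g -> reach c' (gen true j) ->
    reach (c + c' + 2) (amul g (gen false j)).

Lemma reach_mul c c' g g' : reach c g -> reach c' g' -> reach (c + c') (amul g g').
Proof.
  intros Hg Hg'. induction Hg' as [|c' g' e Hg' IH He|c' c2 g' j Hg' IH Hj _].
  - now rewrite Nat.add_0_r, amul_1_r.
  - rewrite amul_assoc, Nat.add_succ_r by assumption. now apply reach_a.
  - rewrite amul_assoc by assumption.
    replace (c + (c' + c2 + 2))%nat with (c + c' + c2 + 2)%nat by lia.
    now apply reach_b.
Qed.

(* Replacing each factor [b^j = t^-1 w t] by [w = a^j] and dropping the other
   letters. It makes excursions [t w t^-1] with [w] in [<b>] superfluous. *)
Lemma reach_exponent c g :
  reach c g -> exists c', (c' <= c)%nat /\ reach c' (gen true (snd g)).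
Proof.
  induction 1 as [|c g e Hg IH He|c c2 g j Hg IH Hj _].
  - exists 0%nat. split; [lia|]. cbn. exact reach_one.
  - destruct IH as (c' & Hc & H). exists c'. split; [lia|]. cbn.
    now rewrite Z.add_0_r.
  - destruct IH as (c' & Hc & H). exists (c' + c2)%nat. split; [lia|].
    cbn [snd amul]. change (snd (amul g (gen false j))) with (snd g + j)%Z.
    rewrite <- gen_add. now apply reach_mul.
Qed.

(** The cost of a state: one for each stable letter, plus the costs of the pieces in between. The
    factor [gen (negb b) (coord b h)] carried across a letter is free, being paid for within [h]. *)
Inductive parse : nat -> list (affine * bool) -> affine -> Prop :=
| parse_nil c g : reach c g -> parse c [] g
| parse_cons c c' l h g b : parse c l h -> reach c' g ->
    parse (c + 1 + c') ((rep b h, b) :: l) (amul (gen (negb b) (coord b h)) g).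

Lemma parse_mul c c' l h g : parse c l h -> reach c' g -> parse (c + c') l (amul h g).
Proof.
  intros H Hg. destruct H as [c h H|c c2 l h g2 b H Hg2].
  - apply parse_nil. now apply reach_mul.
  - rewrite <- amul_assoc by assumption. rewrite <- Nat.add_assoc.
    apply parse_cons; [assumption | now apply reach_mul].
Qed.

(** Removing a pinch: [t^-1 a^k t] becomes a factor [b^k], whose surcharge 2 is that of the two
    stable letters; [t b^k t^-1] becomes [a^k] by [reach_exponent]. *)
Lemma reach_turn c b k :
  reach c (gen b k) -> exists c', (c' <= c + 2)%nat /\ reach c' (gen (negb b) k).
Proof.
  destruct b; intros H.
  - exists (c + 2)%nat. split; [lia|]. cbn [negb].
    rewrite <- (amul_1_l (gen false k)). change (c + 2)%nat with (0 + c + 2)%nat.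
    apply reach_b; [exact reach_one | exact H].
  - destruct (reach_exponent _ _ H) as (c' & Hc & H'). exists c'.
    split; [lia | exact H'].
Qed.

Lemma parse_turn c l h b :
  parse c l h -> exists c', (c' <= S c)%nat /\
    parse c' (fst (turn b (l, h))) (snd (turn b (l, h))).
Proof.
  intros H. destruct (classic (cancels b (l, h))) as [Hc|Hn].
  - destruct Hc as (r & l' & E & Hh). cbn [fst snd] in *. subst l.
    rewrite turn_cancel by assumption. cbn [fst snd].
    remember ((r, negb b) :: l') as l eqn:El. destruct H as [|c0 c' l0 h0 g b' H0 Hg];
      [discriminate|]. injection El as Er Eb El. subst r b' l0.
    rewrite Bool.negb_involutive in *.
    set (k0 := coord (negb b) h0) in *. set (k := coord b (amul (gen b k0) g)).
    (* The carried exponent [k0] is already counted in [h0], so only [g], a power in the same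
       subgroup, has to be converted. *)
    assert (Eg : g = gen b (k - k0)).
    { replace (k - k0)%Z with (- k0 + k)%Z by lia. rewrite <- gen_add.
      rewrite <- (amul_1_l (gen b k)), <- Hh. unfold k. rewrite rep_coord by assumption.
      now rewrite amul_assoc, gen_add, Z.add_opp_diag_l, gen_0, amul_1_l. }
    rewrite Eg in Hg. destruct (reach_turn _ _ _ Hg) as (c2 & Hc2 & H2).
    exists (c0 + c2)%nat. split; [lia|].
    replace (amul (rep (negb b) h0) (gen (negb b) k)) with
      (amul h0 (gen (negb b) (k - k0))).
    { now apply parse_mul. }
    unfold rep. rewrite <- amul_assoc, gen_add by assumption. fold k0.
    do 2 f_equal. lia.
  - exists (S c). split; [lia|]. rewrite turn_push by assumption. cbn [fst snd].
    rewrite <- (amul_1_r (gen _ _)). replace (S c) with (c + 1 + 0)%nat by lia.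
    apply parse_cons; [assumption | exact reach_one].
Qed.

Lemma parse_act c s x :
  parse c (fst s) (snd s) ->
  exists c', (c' <= S c)%nat /\ parse c' (fst (act s x)) (snd (act s x)).
Proof.
  destruct s as [l h]. intros H.
  assert (Ha : forall e, e = 1%Z \/ e = (-1)%Z -> parse (S c) l (amul h (gen true e))).
  { intros e He. replace (S c) with (c + 1)%nat by lia. apply parse_mul; [exact H|].
    rewrite <- (amul_1_l (gen true e)). apply reach_a; [exact reach_one | exact He]. }
  destruct x; cbn [act].
  - exists (S c). split; [lia | apply Ha; auto].
  - exists (S c). split; [lia | apply Ha; auto].
  - now apply parse_turn.
  - now apply parse_turn.
Qed.

Lemma parse_run w s c :
  parse c (fst s) (snd s) ->
  exists c', (c' <= c + length w)%nat /\ parse c' (fst (run w s)) (snd (run w s)).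
Proof.
  revert s c. induction w as [|x w IH]; intros s c H.
  - exists c. cbn. split; [lia | exact H].
  - destruct (parse_act _ _ x H) as (c1 & Hc1 & H1).
    destruct (IH _ _ H1) as (c2 & Hc2 & H2). exists c2. cbn [length].
    split; [lia | exact H2].
Qed.

(** Run a geodesic for [a^k] from [start]: each letter raises the cost by at most one, and the final
    state has no frames. *)
Lemma reach_alen k : exists c, (c <= alen k)%nat /\ reach c (gen true k).
Proof.
  destruct (alen_witness k) as [w [Hw <-]].
  destruct (parse_run w start 0) as (c & Hc & H).
  { apply parse_nil. exact reach_one. }
  exists c. split; [exact Hc|].
  rewrite <- (run_weq _ _ start Hw I), run_apow in H by assumption.
  cbn [fst snd start rmul] in H. rewrite amul_1_l in H.
  remember [] as l eqn:El. destruct H; [assumption | discriminate].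
Qed.

(** * From the affine model back to words *)

(* Every element of [<a, b>] is [b^k a^y b^(s - k)] for all large [k]; the shape
   determines the word up to [weq], which transfers equalities from the affine
   model back to the group. *)
Definition bs_spells (w : word) (g : affine) : Prop :=
  exists (k : nat) (y : Z), fst g * pw (Z.of_nat k) = IZR y /\
    weq p w (bpow (Z.of_nat k) ++ apow y ++ bpow (snd g - Z.of_nat k)).

Lemma bs_spells_shift (k i : nat) (y s : Z) :
  weq p (bpow (Z.of_nat k) ++ apow y ++ bpow (s - Z.of_nat k))
    (bpow (Z.of_nat (k + i)) ++ apow (y * Z.of_nat p ^ Z.of_nat i)
       ++ bpow (s - Z.of_nat (k + i))).
Proof.
  replace (s - Z.of_nat k)%Z with (Z.of_nat i + (s - Z.of_nat (k + i)))%Z by lia.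
  rewrite <- bpow_add, (app_assoc (apow y)), apow_bpow.
  rewrite <- !app_assoc, (app_assoc (bpow _) (bpow _)), bpow_add.
  now rewrite <- Nat2Z.inj_add.
Qed.

Lemma bs_spells_a w g e : bs_spells w g -> bs_spells (w ++ apow e) (amul g (gen true e)).
Proof.
  destruct g as [x s]. intros (k & y & Hx & Hw). cbn [fst snd] in *.
  (* [i] makes [k + i >= s], so that [b^-d a^e = a^(e p^d) b^-d] with [d >= 0] moves the new power
     into place. *)
  set (i := Z.to_nat (s - Z.of_nat k)).
  set (d := Z.to_nat (Z.of_nat (k + i) - s)).
  exists (k + i)%nat, (y * Z.of_nat p ^ Z.of_nat i + e * Z.of_nat p ^ Z.of_nat d)%Z.
  cbn [fst snd amul gen]. split.
  - rewrite plus_IZR, !mult_IZR, <- !pw_IZR by lia.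
    rewrite Nat2Z.inj_add, <- Hx, pw_add by assumption.
    replace (Z.of_nat d) with (- s + (Z.of_nat k + Z.of_nat i))%Z by lia.
    rewrite !pw_add by assumption. ring.
  - rewrite Hw, (bs_spells_shift k i), Z.add_0_r, <- apow_add, <- !app_assoc.
    apply weq_app; [reflexivity|]. apply weq_app; [reflexivity|].
    replace (s - Z.of_nat (k + i))%Z with (- Z.of_nat d)%Z by lia.
    transitivity
      (bpow (- Z.of_nat d) ++ (apow e ++ bpow (Z.of_nat d)) ++ bpow (- Z.of_nat d)).
    + now rewrite <- app_assoc, bpow_add, Z.add_opp_diag_r, bpow_0, app_nil_r.
    + rewrite apow_bpow, <- app_assoc, (app_assoc (bpow _) (bpow _)), bpow_add.
      now rewrite Z.add_opp_diag_l, bpow_0.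
Qed.

Lemma bs_spells_b w g j : bs_spells w g -> bs_spells (w ++ bpow j) (amul g (gen false j)).
Proof.
  destruct g as [x s]. intros (k & y & Hx & Hw). exists k, y. cbn [fst snd amul gen] in *.
  rewrite Rmult_0_r, Rplus_0_r. split; [exact Hx|].
  rewrite Hw, <- !app_assoc, bpow_add. now replace (s - Z.of_nat k + j)%Z with
    (s + j - Z.of_nat k)%Z by lia.
Qed.

(** The shape is [b^n a^y b^-n] with [y = k p^n], which [apow_bpow] turns into [a^k]. *)
Lemma bs_spells_apow w k : bs_spells w (gen true k) -> weq p (apow k) w.
Proof.
  intros (n & y & Hx & Hw). cbn [fst snd gen] in *.
  rewrite pw_IZR, <- mult_IZR in Hx by lia. apply eq_IZR in Hx.
  rewrite Hw, <- Hx, app_assoc, <- apow_bpow, <- app_assoc, bpow_add.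
  replace (Z.of_nat n + (0 - Z.of_nat n))%Z with 0%Z by lia.
  now rewrite bpow_0, app_nil_r.
Qed.

Lemma reach_word c g : reach c g -> exists w, (length w <= c)%nat /\ bs_spells w g.
Proof.
  induction 1 as [|c g e Hg IH He|c c2 g j Hg IH Hj IHj].
  - exists []. split; [reflexivity|]. exists 0%nat, 0%Z. cbn [fst snd aone].
    split; [ring|]. change (weq p [] (bpow 0 ++ [] ++ bpow 0)). now rewrite bpow_0.
  - destruct IH as (w & Hc & H). exists (w ++ apow e). split.
    + rewrite length_app.
      destruct He as [-> | ->]; change (length (apow _)) with 1%nat; lia.
    + now apply bs_spells_a.
  - destruct IH as (w & Hc & H), IHj as (w2 & Hc2 & H2).
    exists (w ++ [LT] ++ w2 ++ [Lt]). split.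
    + rewrite !length_app. cbn. lia.
    + apply bs_spells_apow in H2.
      destruct (bs_spells_b w g j H) as (k & y & Hx & Hw). exists k, y.
      split; [exact Hx|]. now rewrite <- Hw, <- H2.
Qed.

(** With [reach_alen], the length of [a^k] is its least cost in the affine model. *)
Lemma alen_le_reach c k : reach c (gen true k) -> (alen k <= c)%nat.
Proof.
  intros H. destruct (reach_word _ _ H) as (w & Hc & Hw).
  apply bs_spells_apow in Hw. apply alen_le_length in Hw. unfold alen in *. lia.
Qed.

(** * Walks on levels *)

(* [j] counts the letters [a^(+-1)], [c] bounds the cost of the factors [b^i],
   and [l] lists the exponents of [b] at which the letters [a^(+-1)] occur. *)
Inductive trace : nat -> nat -> list Z -> affine -> Prop :=
| trace_one : trace 0 0 [] aone
| trace_a j c l g e : trace j c l g -> e = 1%Z \/ e = (-1)%Z ->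
    trace (S j) c (snd g :: l) (amul g (gen true e))
| trace_b j c l g i : trace j c l g ->
    trace j (c + alen i) l (amul g (gen false i)).

Lemma reach_trace n g : reach n g -> exists j c l, (j + c <= n)%nat /\ trace j c l g.
Proof.
  induction 1 as [|n g e Hg IH He|n n2 g i Hg IH Hi _].
  - exists 0%nat, 0%nat, []. split; [lia | exact trace_one].
  - destruct IH as (j & c & l & Hn & H). exists (S j), c, (snd g :: l).
    split; [lia | now apply trace_a].
  - destruct IH as (j & c & l & Hn & H). exists j, (c + alen i)%nat, l.
    apply alen_le_reach in Hi. split; [lia | now apply trace_b].
Qed.

(* The level of an exponent [s] is [- s]. Letters at levels above the window
   contribute multiples of [p^(hi+1)], letters below it at most [p^lo] each. *)
Lemma trace_window j c l g (lo hi : Z) :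
  trace j c l g ->
  (exists s, In s l /\ (lo < - s <= hi)%Z) \/
  (exists (z : Z) (B : R), fst g = IZR z * pw (hi + 1) + B /\ Rabs B <= INR j * pw lo).
Proof.
  induction 1 as [|j c l g e Hg IH He|j c l g i Hg IH].
  - right. exists 0%Z, 0. cbn. rewrite Rabs_R0. split; [ring | lra].
  - destruct IH as [(s & Hs & Hw)|(z & B & Eg & HB)].
    { left. exists s. split; [now right | exact Hw]. }
    cbn [fst amul gen]. set (s := snd g).
    destruct (Z_le_gt_dec (- s) lo) as [Hlo|Hlo];
      [|destruct (Z_le_gt_dec (- s) hi) as [Hhi|Hhi]].
    + right. exists z, (B + pw (- s) * IZR e). split; [rewrite Eg; ring|].
      rewrite S_INR. pose proof (Rabs_triang B (pw (- s) * IZR e)) as HT.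
      rewrite Rabs_mult, (Rabs_pos_eq (pw _)) in HT by apply Rlt_le, pw_pos.
      assert (E : Rabs (IZR e) = 1).
      { rewrite <- abs_IZR. now destruct He; subst e. }
      rewrite E in HT. pose proof (pw_le _ _ Hlo). lra.
    + left. exists s. split; [now left | lia].
    + right. exists (z + e * Z.of_nat p ^ (- s - (hi + 1)))%Z, B. split; [|rewrite S_INR].
      * rewrite Eg, plus_IZR, mult_IZR, <- pw_IZR by lia.
        replace (pw (- s)) with (pw (- s - (hi + 1)) * pw (hi + 1)); [ring|].
        rewrite <- pw_add by assumption. f_equal. lia.
      * pose proof (pw_pos lo). lra.
  - destruct IH as [(s & Hs & Hw)|(z & B & Eg & HB)].
    + left. eauto.
    + right. exists z, B. cbn [fst amul gen]. split; [rewrite Eg; ring | exact HB].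
Qed.

(** The [b]-factors before, between and after two letters have total exponents [s], [s' - s] and
    [snd g - s'], and [alen] is subadditive on each stretch. The disjunction covers both orders of
    the letters. *)
Lemma trace_visits j c l g :
  trace j c l g ->
  (alen (snd g) <= c)%nat /\
  (forall s, In s l -> (alen s + alen (snd g - s) <= c)%nat) /\
  (forall s s', In s l -> In s' l ->
     (alen s + alen (s' - s) + alen (snd g - s') <= c)%nat \/
     (alen s' + alen (s - s') + alen (snd g - s) <= c)%nat).
Proof.
  induction 1 as [|j c l g e Hg IH He|j c l g i Hg IH].
  - split; [cbn; now rewrite alen_0 | split; [intros s [] | intros s s' []]].
  - destruct IH as (H0 & H1 & H2). cbn [snd amul gen]. rewrite Z.add_0_r.
    split; [exact H0|]. split.
    + intros s [<-|Hs]; [rewrite Z.sub_diag, alen_0; lia | auto].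
    + intros s s' [<-|Hs] [<-|Hs']; rewrite ?Z.sub_diag, ?alen_0.
      * left. lia.
      * right. specialize (H1 _ Hs'). lia.
      * left. specialize (H1 _ Hs). lia.
      * auto.
  - destruct IH as (H0 & H1 & H2). cbn [snd amul gen].
    assert (HT : forall s, (alen (snd g + i - s) <= alen (snd g - s) + alen i)%nat).
    { intros s. replace (snd g + i - s)%Z with (snd g - s + i)%Z by lia. apply alen_add. }
    split; [|split].
    + pose proof (alen_add (snd g) i). lia.
    + intros s Hs. specialize (H1 _ Hs). specialize (HT s). lia.
    + intros s s' Hs Hs'. pose proof (HT s). pose proof (HT s').
      destruct (H2 _ _ Hs Hs'); [left | right]; lia.
Qed.

End BaumslagGersten.

(** * The length of [a^(p^u - m)] *)

(** The exponent [j / 3 + 2] balances two needs: three times it is at most [j + 6], yet [j] letters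
    that many levels down stay negligible. *)
Lemma pow_beats_linear (p j : nat) :
  (20 <= p)%nat -> (4 * p * j < p ^ (j / 3 + 2))%nat.
Proof.
  intros hp. rewrite Nat.pow_add_r, Nat.pow_2_r.
  pose proof (Nat.div_mod_eq j 3) as E. pose proof (Nat.mod_upper_bound j 3).
  assert (H1 : (j / 3 < p ^ (j / 3))%nat) by (apply Nat.pow_gt_lin_r; lia).
  set (q := (p ^ (j / 3))%nat) in *. clearbody q.
  assert (4 * j < q * p)%nat by nia. nia.
Qed.

Lemma log_exists (p m : nat) :
  (1 < p)%nat -> (1 <= m)%nat -> exists v, (p ^ v <= m < p ^ S v)%nat.
Proof.
  intros hp hm.
  destruct (nat_least (fun n => (m < p ^ n)%nat) m) as (n & Hn & Hmin).
  { now apply Nat.pow_gt_lin_r. }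
  destruct n as [|v]; [cbn in Hn; lia|]. exists v. split; [|exact Hn].
  destruct (Nat.le_gt_cases (p ^ v) m); [assumption|].
  specialize (Hmin v ltac:(assumption)). lia.
Qed.

(* The carries of [p^u - m] force a visit near level [u] and another near
   level [v]; a letter count [j] shifts these levels by at most [j / 3 + 2]. *)
Lemma alen_pow_sub (p K u v m : nat) :
  (20 <= p)%nat -> (p ^ v <= m < p ^ S v)%nat -> (2 * S v <= u)%nat ->
  (forall z, (S v <= z)%nat -> (K <= alen p (Z.of_nat z))%nat) ->
  (3 * K <= alen p (Z.of_nat (p ^ u) - Z.of_nat m) + 6)%nat.
Proof.
  intros hp Hm Hu HK.
  assert (p_gt1 : (1 < p)%nat) by lia.
  destruct (reach_alen p p_gt1 (Z.of_nat (p ^ u) - Z.of_nat m)) as (n & Hn & H).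
  destruct (reach_trace p p_gt1 _ _ H) as (j & c & l & Hjc & Ht). clear H.
  pose proof (pow_beats_linear p j hp) as He.
  remember (j / 3 + 2)%nat as e eqn:Ee.
  assert (Hsmall : forall z, INR j * pw p (z - Z.of_nat e) < pw p (z - 1) / 4).
  { intros z. unfold Z.sub. rewrite !(pw_add p p_gt1 z).
    apply lt_INR in He. rewrite !mult_INR, pow_INR, <- pw_nat in He.
    replace (INR 4) with 4 in He by (cbn; ring).
    pose proof (pw_opp p p_gt1 (Z.of_nat e)) as E1.
    assert (E2 : INR p * pw p (- (1)) = 1).
    { rewrite <- (pw_opp p p_gt1 1). unfold pw at 2. now rewrite powerRZ_1. }
    pose proof (pw_pos p p_gt1 (- Z.of_nat e)) as Hq.
    pose proof (pw_pos p p_gt1 z) as Hz. pose proof (p_gt1_R p p_gt1) as HP.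
    assert (H1 : 4 * INR p * INR j * pw p (- Z.of_nat e) < INR p * pw p (- (1))).
    { rewrite E2, <- E1. now apply Rmult_lt_compat_r. }
    assert (H2 : 4 * (INR j * pw p (- Z.of_nat e)) < pw p (- (1))).
    { apply Rmult_lt_reg_l with (INR p); lra. }
    apply (Rmult_lt_compat_l _ _ _ Hz) in H2. lra. }
  assert (Hstep : forall z, pw p (z + 1) = INR p * pw p z).
  { intros z. rewrite pw_add by assumption. unfold pw at 2. rewrite powerRZ_1. ring. }
  assert (hpR : 20 <= INR p).
  { apply le_INR in hp. now replace (INR 20) with 20 in hp by (cbn; ring). }
  assert (Efst : fst (gen true (Z.of_nat (p ^ u) - Z.of_nat m)) = pw p (Z.of_nat u) - INR m).
  { cbn [fst gen]. rewrite minus_IZR, <- !INR_IZR_INZ, pow_INR, <- pw_nat. reflexivity. }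
  assert (HmR : pw p (Z.of_nat v) <= INR m < pw p (Z.of_nat v + 1)).
  { replace (Z.of_nat v + 1)%Z with (Z.of_nat (S v)) by lia.
    rewrite !pw_nat, <- !pow_INR. split; [apply le_INR | apply lt_INR]; lia. }
  (* Otherwise [(1 - z p) p^u = m + B]. The left side is nonzero as [p] does not divide 1, so it is
     at least [p^u] in size, but [|m + B| <= (5/4) p^(u-1)]. *)
  assert (Wu : exists s, In s l /\ (Z.of_nat u - Z.of_nat e < - s <= Z.of_nat u)%Z).
  { destruct (trace_window p p_gt1 _ _ _ _ (Z.of_nat u - Z.of_nat e) (Z.of_nat u) Ht)
      as [W|(z & B & Ex & HB)]; [exact W | exfalso].
    rewrite Efst, Hstep in Ex.
    specialize (Hsmall (Z.of_nat u)).
    assert (Hmu : INR m <= pw p (Z.of_nat u - 1)).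
    { apply Rlt_le, Rlt_le_trans with (1 := proj2 HmR). apply pw_le; [exact p_gt1 | lia]. }
    replace (pw p (Z.of_nat u)) with (INR p * pw p (Z.of_nat u - 1)) in Ex
      by (rewrite <- Hstep; f_equal; lia).
    pose proof (pw_pos p p_gt1 (Z.of_nat u - 1)) as HX.
    set (X := pw p (Z.of_nat u - 1)) in *.
    assert (Hq : IZR (1 - z * Z.of_nat p) * (INR p * X) = INR m + B).
    { rewrite minus_IZR, mult_IZR, <- INR_IZR_INZ. lra. }
    pose proof (Rle_abs B) as B1. pose proof (Rle_abs (- B)) as B2. rewrite Rabs_Ropp in B2.
    pose proof (pos_INR m).
    assert (HpX : 20 * X <= INR p * X) by (apply Rmult_le_compat_r; lra).
    assert (Hnz : (1 - z * Z.of_nat p <> 0)%Z).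
    { intros E0. assert (z * Z.of_nat p = 1)%Z by lia.
      assert (Hp' : (20 <= Z.of_nat p)%Z) by (clear - hp; lia). clear - H0 Hp'.
      destruct (Z_le_gt_dec z 0); nia. }
    destruct (Z_lt_le_dec (1 - z * Z.of_nat p) 0) as [Hneg|Hpos].
    - assert (IZR (1 - z * Z.of_nat p) <= -1) by (apply IZR_le; lia). nra.
    - assert (1 <= IZR (1 - z * Z.of_nat p)) by (apply IZR_le; lia). nra. }
  (* Otherwise [m + B] is a multiple of [p^(v+2)], as [p^u] is, yet lies strictly between 0 and
     [p^(v+2)]. The window ends at [S v] because [m] may be close to [p^(v+1)]. *)
  assert (Wv : exists s, In s l /\ (Z.of_nat (S v) - Z.of_nat e < - s <= Z.of_nat (S v))%Z).
  { destruct (trace_window p p_gt1 _ _ _ _ (Z.of_nat (S v) - Z.of_nat e) (Z.of_nat (S v)) Ht)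
      as [W|(z & B & Ex & HB)]; [exact W | exfalso].
    rewrite Efst in Ex.
    replace (Z.of_nat u) with ((Z.of_nat u - (Z.of_nat (S v) + 1)) + (Z.of_nat (S v) + 1))%Z
      in Ex by lia.
    rewrite (pw_add p p_gt1), (pw_IZR p (Z.of_nat u - _)) in Ex by lia.
    specialize (Hsmall (Z.of_nat (S v))).
    replace (Z.of_nat (S v) - 1)%Z with (Z.of_nat v) in Hsmall by lia.
    replace (Z.of_nat (S v)) with (Z.of_nat v + 1)%Z in Ex by lia.
    rewrite !Hstep in Ex. rewrite Hstep in HmR.
    pose proof (pw_pos p p_gt1 (Z.of_nat v)) as HX.
    set (X := pw p (Z.of_nat v)) in *.
    set (r := (Z.of_nat p ^ _)%Z) in Ex.
    assert (Hq : IZR (r - z) * (INR p * (INR p * X)) = INR m + B).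
    { rewrite minus_IZR. lra. }
    pose proof (Rle_abs B) as B1. pose proof (Rle_abs (- B)) as B2. rewrite Rabs_Ropp in B2.
    assert (HpX : 20 * X <= INR p * X) by (apply Rmult_le_compat_r; lra).
    assert (HppX : 20 * (INR p * X) <= INR p * (INR p * X)) by (apply Rmult_le_compat_r; lra).
    destruct (Z_lt_le_dec (r - z) 1) as [Hneg|Hpos].
    - assert (IZR (r - z) <= 0) by (apply IZR_le; lia). nra.
    - assert (1 <= IZR (r - z)) by (apply IZR_le; lia). nra. }
  destruct Wu as (su & Iu & Hsu), Wv as (sv & Iv & Hsv).
  destruct (trace_visits p p_gt1 _ _ _ _ Ht) as (_ & _ & Hvis).
  (* Up to sign, [sv], [su] and [su - sv] are within [e] of [S v], [u] and [u - S v], all of which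
     are at least [S v]. *)
  assert (Kv : (K <= alen p sv + e)%nat).
  { pose proof (HK (S v) ltac:(lia)). rewrite <- alen_opp.
    pose proof (alen_close p (Z.of_nat (S v)) (- sv)). lia. }
  assert (Ku : (K <= alen p su + e)%nat).
  { pose proof (HK u ltac:(lia)). rewrite <- alen_opp.
    pose proof (alen_close p (Z.of_nat u) (- su)). lia. }
  assert (Kuv : (K <= alen p (su - sv) + e)%nat).
  { pose proof (HK (u - S v)%nat ltac:(lia)). rewrite <- alen_opp.
    pose proof (alen_close p (Z.of_nat (u - S v)) (- (su - sv))). lia. }
  (* The three losses of [e] are absorbed by the [j] letters, which count towards [n] besides
     [c]. *)
  assert (He3 : (3 * e <= j + 6)%nat).
  { pose proof (Nat.div_mod_eq j 3). lia. }
  pose proof (alen_opp p su) as Ou. pose proof (alen_opp p sv) as Ov.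
  pose proof (alen_opp p (su - sv)) as Ouv.
  replace (- (su - sv))%Z with (sv - su)%Z in Ouv by lia.
  destruct (Hvis su sv Iu Iv) as [Hc|Hc]; cbn [snd gen] in Hc;
    rewrite !Z.sub_0_l in Hc; lia.
Qed.

(** * The infimum and the cones *)

Lemma is_glb_exists (S : R -> Prop) (x0 : R) :
  S x0 -> (forall x, S x -> 0 <= x) -> exists s, is_glb S s.
Proof.
  intros H0 Hpos.
  destruct (completeness (fun x => S (- x))) as (s & Hub & Hlub).
  - exists 0. intros x Hx. specialize (Hpos _ Hx). lra.
  - exists (- x0). now rewrite Ropp_involutive.
  - exists (- s). split.
    + intros x Hx. assert (- x <= s); [|lra]. apply Hub. now rewrite Ropp_involutive.
    + intros b Hb. assert (s <= - b); [|lra]. apply Hlub. intros x Hx.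
      specialize (Hb _ Hx). lra.
Qed.

(** As [|m + n| <= 2 (K + 6) + 5] and [3 K <= |n| + 6], the constant is [3 * 17 + 2 * 6 = 63]. *)
Lemma orbit_close (p m : nat) :
  (20 <= p)%nat ->
  exists n : nat, (3 * alen p (Z.of_nat (m + n)) <= 2 * alen p (Z.of_nat n) + 63)%nat.
Proof.
  intros hp. destruct m as [|m'].
  { exists 0%nat. rewrite alen_0. lia. }
  set (m := S m'). destruct (log_exists p m) as (v & Hv); [lia | unfold m; lia|].
  (* Minimising over all [z >= S v] lets the same [K] bound all three stretches of the walk. *)
  destruct (nat_least (fun k => exists z, (S v <= z)%nat /\ alen p (Z.of_nat z) = k)
    (alen p (Z.of_nat (S v)))) as (K & (z & Hz & Ez) & HK).
  { exists (S v). split; [lia | reflexivity]. }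
  (* The factor [p] makes [u - S v >= S v] while raising the length by at most 6. *)
  set (u := (z * p)%nat).
  assert (Hu : (2 * S v <= u)%nat) by (unfold u; nia).
  assert (Hmu : (m <= p ^ u)%nat).
  { apply Nat.le_trans with (p ^ S v)%nat; [lia|]. apply Nat.pow_le_mono_r; lia. }
  exists (p ^ u - m)%nat.
  replace (m + (p ^ u - m))%nat with (p ^ u)%nat by lia.
  rewrite Nat2Z.inj_sub by exact Hmu.
  assert (Hlow : (3 * K <= alen p (Z.of_nat (p ^ u) - Z.of_nat m) + 6)%nat).
  { apply alen_pow_sub with (v := v); try assumption. intros y Hy. apply HK. eauto. }
  pose proof (alen_pow_p p u) as H1. rewrite <- Nat2Z.inj_pow in H1.
  pose proof (alen_mul_p p (Z.of_nat z)) as H2. rewrite <- Nat2Z.inj_mul in H2.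
  fold u in H2. lia.
Qed.

(* t(a^infty, a^-infty) = sqrt s, s = inf of s_set; the existence of the
   infimum s (i.e. the set is nonempty) is part of the claim t <= sqrt(12/17). *)
Theorem theorem4p3 (p : nat) (hp : (20 <= p)%nat) :
  infinite_order p [La] /\
  exists s : R, is_glb (s_set p [La] [LA]) s /\ sqrt s <= sqrt (12 / 17).
Proof.
  split.
  - intros n hn H. rewrite wpow_La in H. apply (apow_inj p) with (j := 0%Z) in H; lia.
  - assert (Hmem : s_set p [La] [LA] (12 / 17)).
    (* [63 / 3 = 21], and the slope [2 / 3] is below [12 / 17]. *)
    { split; [lra|]. exists 21%nat.
      assert (Hcone : forall m, exists n : nat,
        INR (alen p (Z.of_nat (m + n))) <= 12 / 17 * INR (alen p (Z.of_nat n)) + INR 21).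
      { intros m. destruct (orbit_close p m hp) as (n & Hn). exists n.
        apply le_INR in Hn. rewrite plus_INR, !mult_INR in Hn.
        replace (INR 63) with 63 in Hn by (cbn; ring).
        replace (INR 3) with 3 in Hn by (cbn; ring).
        replace (INR 2) with 2 in Hn by (cbn; ring).
        replace (INR 21) with 21 by (cbn; ring).
        pose proof (pos_INR (alen p (Z.of_nat n))). lra. }
      (* In both cones the distance to be bounded, from [a^m] to [a^-n] or from [a^-m] to [a^n], is
         [|m + n|]. *)
      split; intros m; destruct (Hcone m) as (n & Hn); exists n; unfold Defs.dist;
        rewrite !wpow_La, !wpow_LA; change (winv []) with (@nil letter); cbn [app].
      - rewrite <- winv_app, !wlen_winv.
        rewrite (wlen_ext p _ _ (apow_add p _ _)), <- Nat2Z.inj_add, Nat.add_comm.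
        exact Hn.
      - rewrite winv_involutive.
        rewrite (wlen_ext p _ _ (apow_add p _ _)), <- Nat2Z.inj_add. exact Hn. }
    destruct (is_glb_exists _ _ Hmem) as (s & Hs).
    { intros x [Hx _]. lra. }
    exists s. split; [exact Hs|]. apply sqrt_le_1_alt. now apply Hs.
Qed.
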